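(* Let $\mu \in \mathbb{R}$, $\rho > 0$ and $\beta \in \mathbb{R}$, and let $x_1, x_2, \ldots$ be i.i.d. samples of a random variable $X$ having the Gaussian density $N(x;\mu,\rho)$ with mean $\mu$ and precision $\rho$ (i.e. variance $1/\rho$). Then the expected update of the learning rule $v \leftarrow v + 2\alpha\,\sigma_\beta(x-v)\,(x-v)$ (with the learning rate factor $\alpha$ omitted), namely the function $J:\mathbb{R}\to\mathbb{R}$ given by $$J(v) = 2\,\mathbf{E}\bigl[\sigma_\beta(X-v)\cdot(X-v)\bigr] = 2\int_{\mathbb{R}} N(x;\mu,\rho)\,\sigma_\beta(x-v)\,(x-v)\,dx,$$ is twice differentiable in $v$ and satisfies $$J(v)\ \begin{cases} <0, & \text{if } v > \mathbf{F}_\beta,\\ =0, & \text{if } v = \mathbf{F}_\beta,\\ >0, & \text{if } v < \mathbf{F}_\beta,\end{cases}$$ where $\mathbf{F}_\beta = \mu + \frac{\beta}{2\rho}$ is the Gaussian free energy at inverse temperature $\beta$.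
   Context: The Gaussian density with mean $\mu\in\mathbb{R}$ and precision $\rho>0$ is $N(x;\mu,\rho) = \sqrt{\frac{\rho}{2\pi}}\exp\{-\frac{\rho}{2}(x-\mu)^2\}$. For $\beta\in\mathbb{R}$, the scaled logistic sigmoid is $\sigma_\beta(z) = \frac{1}{1+\exp\{-\beta z\}}$, $z \in \mathbb{R}$. The free energy at inverse temperature $\beta$ is $\mathbf{F}_\beta = \frac{1}{\beta}\log\int_{\mathbb{R}} N(x;\mu,\rho)\exp\{\beta x\}\,dx = \mu+\frac{\beta}{2\rho}$; for $\beta = 0$ it is understood as the value $\mathbf{F}_0 = \mu$ (the limit $\beta\to 0$). The learning rule is: given a current estimate $v\in\mathbb{R}$ and a new sample $x$, replace $v$ by $v + 2\alpha\,\sigma_\beta(x-v)\,(x-v)$, where $\alpha>0$ is a learning rate. *)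

(* Defs.v *)
From HB Require Import structures.
From mathcomp Require Import all_boot all_order all_algebra.
From mathcomp Require Import all_classical all_reals all_analysis.
From mathcomp Require Import ring.
Set Implicit Arguments.
Unset Strict Implicit.
Unset Printing Implicit Defensive.
Import Order.TTheory GRing.Theory Num.Theory.
Import numFieldNormedType.Exports.
Local Open Scope classical_set_scope.
Local Open Scope ring_scope.

Definition gaussian_density {R : realType} (mu rho x : R) : R :=
  Num.sqrt (rho / (2 * pi)) * expR (- (rho / 2) * (x - mu) ^+ 2).

(* The library's [normal_pdf] takes the standard deviation, not the
   precision. *)
Lemma gaussian_densityE {R : realType} (mu rho x : R) : 0 < rho ->
  gaussian_density mu rho x = normal_pdf mu (Num.sqrt rho)^-1 x.
Proof.
move=> rho0; have s0 : Num.sqrt rho != 0 by rewrite sqrtr_eq0 -ltNge.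
have pi0 : (pi : R) != 0 by rewrite gt_eqF ?pi_gt0.
rewrite normal_pdfE ?invr_eq0// /normal_peak /normal_fun /gaussian_density.
rewrite exprVn sqr_sqrtr ?(ltW rho0)// -sqrtrV; last first.
  by rewrite mulrn_wge0// mulr_ge0 ?invr_ge0 ?pi_ge0 ?ltW.
have rhoN0 : rho != 0 by rewrite gt_eqF.
congr (Num.sqrt _ * expR _); last by field.
by move: (pi) pi0 => p p0; field; rewrite rhoN0.
Qed.

Definition sigmoid {R : realType} (beta z : R) : R :=
  (1 + expR (- (beta * z)))^-1.

(* At beta = 0 the formula beta^-1 * ln _ has no meaning; mu is its limit as
   beta tends to 0. *)
Definition free_energy {R : realType} (mu rho beta : R) : R :=
  if beta == 0 then mu
  else beta^-1 * ln (\int[lebesgue_measure]_x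
                       (gaussian_density mu rho x * expR (beta * x))).

Definition learning_step {R : realType} (alpha beta v x : R) : R :=
  v + 2 * alpha * sigmoid beta (x - v) * (x - v).

Section random_variables.
Context {d : measure_display} {T : measurableType d} {R : realType}.
Variable P : probability T R.

Definition has_density (X : {RV P >-> R}) (f : R -> R) : Prop :=
  forall A : set R, measurable A ->
    distribution P X A = (\int[lebesgue_measure]_(x in A) (f x)%:E)%E.

Definition mutually_independent (x : nat -> {RV P >-> R}) : Prop :=
  forall (I : seq nat) (B : nat -> set R), uniq I ->
    (forall i, measurable (B i)) ->
    P (\bigcap_(i in [set` I]) (x i @^-1` B i)) =
    (\prod_(i <- I) P (x i @^-1` B i))%E.

Definition iid_samples (X : {RV P >-> R}) (x : nat -> {RV P >-> R}) : Prop :=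
  mutually_independent x /\
  forall (i : nat) (A : set R), measurable A ->
    distribution P (x i) A = distribution P X A.

(* [fine] sends infinite values to 0, so that the expectation exists has to be
   stated separately. *)
Definition expected_update (X : {RV P >-> R}) (beta v : R) : R :=
  2 * fine ('E_P[fun w => (sigmoid beta (X w - v) * (X w - v))%R])%E.

End random_variables.

(* Main.v *)
(* Let h(z) = z sigma_beta(z), so that J(v) = 2 E[h(X - v)]. The functions h, h'
   and h'' grow at most linearly and X has a first moment, so J may be
   differentiated twice under the expectation. For the sign, average the integrand
   of J over the reflection y -> 2v - y. Since
   sigma_beta(-z) = exp(- beta z) sigma_beta(z), this gives, with z = y - v,
     J(v) = int N(y) sigma_beta(z) z (1 - exp(2 rho z (v - F_beta))) dy,
   whose integrand has the sign of F_beta - v for every z <> 0. *)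

Require Import Defs.
From HB Require Import structures.
From mathcomp Require Import all_boot all_order all_algebra.
From mathcomp Require Import all_classical all_reals all_analysis.
From mathcomp Require Import measurable_realfun ring lra.
Set Implicit Arguments.
Unset Strict Implicit.
Unset Printing Implicit Defensive.
Import Order.TTheory GRing.Theory Num.Theory.
Import numFieldNormedType.Exports.
Local Open Scope classical_set_scope.
Local Open Scope ring_scope.

(** * Integration against a measure given by a density *)

Section density.
Local Open Scope ereal_scope.
Context d (T : measurableType d) (R : realType).
Variables (nu : {finite_measure set T -> \bar R})
          (mu : {sigma_finite_measure set T -> \bar R}) (p : T -> R).
Hypothesis p_ge0 : forall x, (0 <= p x)%R.
Hypothesis int_p : mu.-integrable setT (EFin \o p).
Hypothesis nuE : forall A, measurable A -> nu A = \int[mu]_(x in A) (p x)%:E.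

Lemma density_dominates : nu `<< mu.
Proof.
apply/null_content_dominatesP => A mA muA0; rewrite nuE//.
apply: null_set_integral => //.
apply/measurable_EFinP/measurable_funTS/measurable_EFinP.
exact: measurable_int int_p.
Qed.

(** The function [p] and the Radon-Nikodym derivative of [nu] have the same integral over every
    measurable set, so they agree [mu]-almost everywhere and the change of variables for the latter
    carries over to [p]. *)
Lemma ge0_integral_density (f : T -> \bar R) :
  measurable_fun setT f -> (forall x, 0 <= f x) ->
  \int[nu]_x f x = \int[mu]_x (f x * (p x)%:E).
Proof.
move=> mf f0; have numu := density_dominates.
have mp := measurable_int _ int_p.
pose g := Radon_Nikodym_SigmaFinite.f nu mu.
have ig : mu.-integrable setT g.
  exact: Radon_Nikodym_SigmaFinite.f_integrable.
rewrite -(Radon_Nikodym_SigmaFinite.change_of_variables numu f0 measurableT mf).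
apply: ae_eq_integral => //.
- by apply: emeasurable_funM => //; exact: measurable_int ig.
- exact: emeasurable_funM.
- apply: ae_eqe_mul2l; apply: integral_ae_eq => // E _ mE.
  by rewrite -Radon_Nikodym_SigmaFinite.f_integral// -nuE.
Qed.

Lemma integrable_density (f : T -> \bar R) : measurable_fun setT f ->
  nu.-integrable setT f <-> mu.-integrable setT (fun x => f x * (p x)%:E).
Proof.
move=> mf.
have E : \int[nu]_x `|f x| = \int[mu]_x `|f x * (p x)%:E|.
  rewrite ge0_integral_density//; last exact: measurableT_comp.
  by apply: eq_integral => x _; rewrite abseM [`|(p x)%:E|]gee0_abs// lee_fin.
split=> /integrableP[mf' foo]; apply/integrableP; split.
- by apply: emeasurable_funM => //; exact: measurable_int int_p.
- by rewrite -E.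
- by [].
- by rewrite E.
Qed.

(** Multiplication by the nonnegative [p] commutes with taking positive and negative parts, which
    reduces the claim to nonnegative functions. *)
Lemma integral_density (f : T -> \bar R) : nu.-integrable setT f ->
  \int[nu]_x f x = \int[mu]_x (f x * (p x)%:E).
Proof.
move=> intf; have mf := measurable_int _ intf.
rewrite integralE [in RHS]integralE; congr (_ - _).
  rewrite ge0_integral_density//; last exact: measurable_funepos.
  apply: eq_integral => x _; rewrite muleC.
  have /(congr1 (@^~ x))/= <- := ge0_funeposM f (p_ge0 x).
  by rewrite !funeposE muleC.
rewrite ge0_integral_density//; last exact: measurable_funeneg.
apply: eq_integral => x _; rewrite muleC.
have /(congr1 (@^~ x))/= <- := ge0_funenegM f (p_ge0 x).
by rewrite !funenegE muleC.
Qed.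

End density.

(** * The Gaussian density: sign, total mass, exponential tilting *)

Section gaussian.
Context {R : realType}.
Variables (mu rho : R).
Hypothesis rho_gt0 : 0 < rho.
Local Notation leb := (@lebesgue_measure R).
Local Notation N := (gaussian_density mu rho).

Lemma gaussian_density_gt0 x : 0 < N x.
Proof.
rewrite mulr_gt0 ?expR_gt0// sqrtr_gt0 divr_gt0// mulr_gt0//; exact: pi_gt0.
Qed.

Lemma measurable_gaussian_density : measurable_fun [set: R] N.
Proof.
rewrite (_ : N = normal_pdf mu (Num.sqrt rho)^-1).
  exact: measurable_normal_pdf.
by apply/funext => x; exact: gaussian_densityE.
Qed.

(** Completing the square: tilting by exp(t x) shifts the mean by t / rho, keeps the precision, and
    leaves the moment generating function at [t] as a factor. *)
Lemma gaussian_density_tilt t x :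
  N x * expR (t * x) =
  expR (t * mu + t ^+ 2 / (2 * rho)) * gaussian_density (mu + t / rho) rho x.
Proof.
rewrite /gaussian_density -mulrA -expRD [RHS]mulrCA -expRD.
have rho0 : rho != 0 by rewrite gt_eqF.
by congr (_ * expR _); field.
Qed.

Lemma integrable_gaussian_density : leb.-integrable setT (EFin \o N).
Proof.
apply: eq_integrable (integrable_normal_pdf mu (Num.sqrt rho)^-1) => //= x _.
by rewrite gaussian_densityE.
Qed.

Lemma integral_gaussian_density : (\int[leb]_x (N x)%:E = 1)%E.
Proof.
under eq_integral do rewrite gaussian_densityE//.
exact: integral_normal_pdf.
Qed.

End gaussian.

(** * Exponential and first moments of the Gaussian, and the free energy *)

Section gaussian_moments.
Context {R : realType}.
Variables (mu rho : R).
Hypothesis rho_gt0 : 0 < rho.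
Local Notation leb := (@lebesgue_measure R).
Local Notation N := (gaussian_density mu rho).

Lemma integrable_gaussian_density_expR t :
  leb.-integrable setT (fun x => (N x * expR (t * x))%:E).
Proof.
under eq_fun do rewrite gaussian_density_tilt// EFinM.
by apply: integrableZl => //; exact: integrable_gaussian_density.
Qed.

Lemma integral_gaussian_density_expR t :
  \int[leb]_x (N x * expR (t * x)) = expR (t * mu + t ^+ 2 / (2 * rho)).
Proof.
rewrite /Rintegral; under eq_integral do rewrite gaussian_density_tilt// EFinM.
rewrite integralZl//; last exact: integrable_gaussian_density.
by rewrite integral_gaussian_density// mule1.
Qed.

Lemma free_energyE beta : free_energy mu rho beta = mu + beta / (2 * rho).
Proof.
rewrite /free_energy; have [->|beta0] := eqVneq; first by rewrite mul0r addr0.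
rewrite integral_gaussian_density_expR expRK.
have rho0 : rho != 0 by rewrite gt_eqF.
by field; rewrite rho0 beta0.
Qed.

(** Since 1 + x <= exp x, one has |x| <= exp x + exp(-x), so the exponential moments at 1 and -1
    dominate the first moment. *)
Lemma integrable_gaussian_density_id :
  leb.-integrable setT (fun x => (x%:E * (N x)%:E)%E).
Proof.
have ie := integrableD measurableT (integrable_gaussian_density_expR 1)
  (integrable_gaussian_density_expR (-1)).
apply: le_integrable ie => //.
  apply/measurable_EFinP/measurable_funM => //.
  exact: measurable_gaussian_density.
move=> x _ /=; rewrite lee_fin mul1r mulN1r -mulrDr mulrC !(normrM (N x)).
rewrite ler_wpM2l// [leRHS]ger0_norm ?addr_ge0 ?expR_ge0//.
have := expR_ge1Dx x; have := expR_ge1Dx (- x).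
have := expR_gt0 x; have := expR_gt0 (- x).
by have [?|?] := ler0P x; lra.
Qed.

End gaussian_moments.

(** * Differentiating the expectation of a translated function *)

Lemma is_derive_continuous {R : realType} (f f' : R -> R) :
  (forall z : R, is_derive z (1 : R) f (f' z)) -> continuous f.
Proof.
move=> df z; apply: differentiable_continuous; apply/derivable1_diffP.
by case: (df z).
Qed.

Section expectation_of_translates.
Context {R : realType}.
Variable Q : probability (measurableTypeR R) R.
Hypothesis int_id : Q.-integrable setT (EFin : R -> \bar R).
Implicit Types h : R -> R.

(** This growth class suits a law with a first moment: translates over a bounded range share one
    integrable bound. Evaluating at 0 shows that [C] is automatically nonnegative. *)
Definition linear_growth h := exists C, forall z, `|h z| <= C * (1 + `|z|).

Lemma linear_growth_bound h : linear_growth h ->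
  exists2 C, 0 <= C & forall z, `|h z| <= C * (1 + `|z|).
Proof.
move=> [C hC]; exists C => //; have := hC 0; rewrite normr0 addr0 mulr1.
exact: le_trans.
Qed.

Lemma integrable_affine_norm (a b : R) :
  Q.-integrable setT (fun y : R => (a * (b + `|y|))%:E).
Proof.
under eq_fun do rewrite EFinM EFinD.
apply: integrableZl => //; apply: integrableD => //.
  exact: finite_measure_integrable_cst.
exact: (integrable_abse int_id).
Qed.

Lemma measurable_translate h v : continuous h ->
  measurable_fun setT (fun y : measurableTypeR R => h (y - v)).
Proof.
move=> ch; apply: (@measurableT_comp _ _ _ _ _ _ h) => //.
  exact: continuous_measurable_fun.
exact: measurable_funB.
Qed.

Lemma integrable_translate h v : continuous h -> linear_growth h ->
  Q.-integrable setT (fun y => (h (y - v))%:E).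
Proof.
move=> ch /linear_growth_bound[C C0 hC].
apply: (le_integrable measurableT _ _ (integrable_affine_norm C (1 + `|v|))).
  by apply/measurable_EFinP; exact: measurable_translate.
move=> y _; rewrite lee_fin (le_trans (hC _))// ger0_norm; last first.
  by rewrite mulr_ge0// !addr_ge0.
rewrite ler_wpM2l// -addrA lerD2l (le_trans (ler_normB _ _))//.
by rewrite addrC.
Qed.

(** Dominated differentiation on the interval of radius 1 about [v]; the minus sign comes from the
    inner function w -> y - w. *)
Lemma is_derive_integral_translate h h' (v : R) :
  (forall z : R, is_derive z (1 : R) h (h' z)) -> continuous h' ->
  linear_growth h -> linear_growth h' ->
  is_derive v (1 : R) (fun v => \int[Q]_y h (y - v)) (- \int[Q]_y h' (y - v)).
Proof.
move=> dh ch' gh gh'; have /linear_growth_bound[C C0 h'C] := gh'.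
have ch := is_derive_continuous dh.
pose f (w : R) (y : measurableTypeR R) := h (y - w).
have df (w y : R) : is_derive w (1 : R) (f ^~ y) (- h' (y - w)).
  have dg : is_derive w (1 : R) (fun x : R => y - x) (-1).
    by apply: is_derive_eq; rewrite add0r mul1r.
  have dhg : is_derive ((fun x : R => y - x) w) (1 : R) h (h' (y - w)).
    exact: dh.
  have := @is_derive1_comp _ h (fun x : R => y - x) w _ _ dhg dg.
  by rewrite mulrN1.
have d1f (w y : R) : partial1of2 f w y = - h' (y - w).
  by rewrite partial1of2E; case: (df w y).
have Iv : `]v - 1, v + 1[%classic v.
  by rewrite /= in_itv/= ltrBlDr ltrDl ltr01.
have intf w : `]v - 1, v + 1[%classic w -> Q.-integrable setT (EFin \o f w).
  by move=> _; exact: integrable_translate.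
have derf w y : `]v - 1, v + 1[%classic w -> setT y -> derivable (f ^~ y) w 1.
  by move=> _ _; case: (df w y).
(* For [w] within 1 of [v], 1 + |y - w| <= 1 + |y| + |w| <= 2 + |v| + |y|, so [G] dominates
   uniformly in [w]. *)
pose G (y : measurableTypeR R) := C * (2 + `|v| + `|y|).
have G0 y : 0 <= G y by rewrite mulr_ge0// !addr_ge0.
have intG : Q.-integrable setT (EFin \o G) by exact: integrable_affine_norm.
have Gub w y : `]v - 1, v + 1[%classic w -> setT y ->
    `|partial1of2 f w y| <= G y.
  rewrite /= in_itv/= => /andP[w1 w2] _.
  rewrite d1f normrN (le_trans (h'C _))//.
  rewrite ler_wpM2l// (le_trans (lerD (lexx _) (ler_normB _ _)))//.
  have : `|w| <= `|v| + 1.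
    rewrite -(subrK v w) addrC (le_trans (ler_normD _ _))// lerD2l ler_norml.
    by rewrite lerBrDr lerBlDr addrC [1 + v]addrC !ltW.
  lra.
constructor.
  exact: (derivable_under_integral measurableT Iv intf derf G0 intG Gub).
rewrite -derive1E.
rewrite (differentiation_under_integral measurableT Iv intf derf G0 intG Gub).
rewrite -mulN1r -RintegralZl//; last exact: integrable_translate.
by apply: eq_Rintegral => y _; rewrite [LHS]d1f mulN1r.
Qed.

End expectation_of_translates.

(** * The sigmoid, and the update function with its first two derivatives *)

Section sigmoid.
Context {R : realType}.
Variable beta : R.
Local Notation s := (sigmoid beta).

Lemma sigmoid_gt0 z : 0 < s z.
Proof. by rewrite invr_gt0 addr_gt0// expR_gt0. Qed.

Lemma sigmoid_lt1 z : s z < 1.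
Proof. by rewrite invf_lt1 ?addr_gt0 ?expR_gt0// ltrDl expR_gt0. Qed.

Lemma sigmoidN z : s (- z) = expR (- (beta * z)) * s z.
Proof.
rewrite /sigmoid mulrN opprK expRN.
have e0 := expR_gt0 (beta * z).
have e1 : expR (beta * z) != 0 by rewrite gt_eqF.
have e2 : 1 + expR (beta * z) != 0 by rewrite gt_eqF// addr_gt0.
by move: (expR _) e0 e1 e2 => e e0 e1 e2; field; rewrite e1 addrC e2.
Qed.

Lemma is_derive_sigmoid (z : R) :
  is_derive z (1 : R) s (beta * s z * (1 - s z)).
Proof.
have e0 : 1 + expR (- (beta * z)) != 0 by rewrite gt_eqF// addr_gt0 ?expR_gt0.
have dl : is_derive z (1 : R) (fun x : R => - (beta * x)) (- beta).
  by apply: is_derive_eq; rewrite /GRing.scale/=; ring.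
have de := @is_derive1_comp _ expR (fun x : R => - (beta * x)) z _ _
  (is_derive_expR _) dl.
have d1 : is_derive z (1 : R) (fun x : R => 1 + expR (- (beta * x)))
    (0 + expR (- (beta * z)) * - beta).
  exact: is_deriveD.
have dV := @is_deriveV _ (fun x : R => 1 + expR (- (beta * x))) z _ 1 e0 d1.
apply: (is_derive_eq dV).
rewrite /sigmoid; move: (expR _) e0 => e e0.
by rewrite /GRing.scale/=; field.
Qed.

(** This is the function h of the overview, followed by h' and h''. By s' = beta s (1 - s), both
    derivatives are polynomials in [beta], [s z] and [z], so 0 < s < 1 suffices to bound their
    growth. *)
Definition update z := s z * z.
Definition update' z := s z + beta * s z * (1 - s z) * z.
Definition update'' z := beta * s z * (1 - s z) *
  (2 + beta * (1 - 2 * s z) * z).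

Lemma is_derive_update (z : R) : is_derive z (1 : R) update (update' z).
Proof.
have ds := is_derive_sigmoid z.
apply: (is_derive_eq (is_deriveM ds (is_derive_id z (1 : R)))).
by rewrite /GRing.scale/= /update'; ring.
Qed.

Lemma is_derive_update' (z : R) : is_derive z (1 : R) update' (update'' z).
Proof.
have ds := is_derive_sigmoid z.
have dbs := is_deriveM (is_derive_cst beta z (1 : R)) ds.
have d1s := is_deriveB (is_derive_cst (1 : R) z (1 : R)) ds.
have d2 := is_deriveM (is_deriveM dbs d1s) (is_derive_id z (1 : R)).
apply: (is_derive_eq (is_deriveD ds d2)).
by rewrite /GRing.scale/= /update'' !fctE/=; ring.
Qed.

(** Differentiating J twice requires h'' to be continuous; for h and h' continuity follows from
    differentiability. *)
Lemma continuous_update'' : continuous update''.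
Proof.
have cs : continuous s := is_derive_continuous is_derive_sigmoid.
move=> z; rewrite /continuous_at /update''.
have cM (f g : R -> R) : f @ z --> f z -> g @ z --> g z ->
  f w * g w @[w --> z] --> f z * g z by move=> cf cg; exact: cvgM.
have cB (f g : R -> R) : f @ z --> f z -> g @ z --> g z ->
  f w - g w @[w --> z] --> f z - g z by move=> cf cg; exact: cvgB.
apply: (cM (fun z => beta * s z * (1 - s z))).
  apply: (cM (fun z => beta * s z)).
    by apply: (cM (fun=> beta)); [exact: cvg_cst|exact: cs].
  by apply: (cB (fun=> 1)); [exact: cvg_cst|exact: cs].
apply: cvgD; first exact: cvg_cst.
apply: (cM (fun z => beta * (1 - 2 * s z))); last exact: cvg_id.
apply: (cM (fun=> beta)); first exact: cvg_cst.
apply: (cB (fun=> 1)); first exact: cvg_cst.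
by apply: (cM (fun=> 2)); [exact: cvg_cst|exact: cs].
Qed.

Lemma sigmoid_variance_bound z : 0 <= s z * (1 - s z) <= 1.
Proof.
have := sigmoid_gt0 z; have := sigmoid_lt1 z.
move: (s z) => p p1 p0; apply/andP; split; nra.
Qed.

Lemma linear_growth_update : linear_growth update.
Proof.
exists 1 => z; rewrite mul1r normrM gtr0_norm ?sigmoid_gt0//.
have := sigmoid_gt0 z; have := sigmoid_lt1 z; have := normr_ge0 z.
move: (s z) `|z| => p q *; nra.
Qed.

Lemma linear_growth_update' : linear_growth update'.
Proof.
(* The bound established is 1 + |beta| |z|, which is at most (1 + |beta|)(1 + |z|). *)
exists (1 + `|beta|) => z; rewrite /update' (le_trans (ler_normD _ _))//.
rewrite gtr0_norm ?sigmoid_gt0// -(mulrA beta) !normrM.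
have /andP[v0 v1] := sigmoid_variance_bound z.
rewrite -(normrM (s z)) [`|s z * _|]ger0_norm//.
have := sigmoid_lt1 z; have := normr_ge0 z; have := normr_ge0 beta.
move: (s z) (s z * (1 - s z)) v0 v1 `|z| `|beta| => p v v0 v1 q b b0 q0 p1.
have : b * v * q <= b * q by rewrite ler_wpM2r// ler_piMr.
by have := mulr_ge0 b0 q0; lra.
Qed.

Lemma linear_growth_update'' : linear_growth update''.
Proof.
(* Here s (1 - s) <= 1 and |1 - 2 s| <= 1 give the bound |beta| (2 + |beta| |z|). *)
exists (`|beta| * (2 + `|beta|)) => z.
have r1 : `|1 - 2 * s z| <= 1.
  have := sigmoid_gt0 z; have := sigmoid_lt1 z.
  by rewrite ler_norml => *; apply/andP; split; lra.
have /andP[v0 v1] := sigmoid_variance_bound z.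
rewrite /update'' -(mulrA beta).
move: (1 - 2 * s z) (s z * (1 - s z)) r1 v0 v1 => r v r1 v0 v1.
rewrite !normrM (ger0_norm v0) -!mulrA ler_wpM2l//.
rewrite (le_trans (ler_wpM2r _ v1))// mul1r (le_trans (ler_normD _ _))//.
rewrite [`|2|]ger0_norm// !normrM.
move: `|r| `|z| `|beta| (normr_ge0 z) (normr_ge0 beta) r1 => {}r q b q0 b0 r1.
have : b * (r * q) <= b * q by rewrite ler_wpM2l// ler_piMl.
by have := mulr_ge0 b0 q0; lra.
Qed.

End sigmoid.

(** * Invariance of Lebesgue measure under reflections of the line *)

Section reflection.
Context {R : realType}.
Variable c : R.
Local Notation leb := (@lebesgue_measure R).

Let refl (y : measurableTypeR R) : measurableTypeR R := c - y.

Let measurable_refl : measurable_fun setT refl.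
Proof. exact: measurable_funB. Qed.

Lemma lebesgue_measure_reflection A : measurable A ->
  pushforward leb refl A = leb A.
Proof.
move=> mA; apply/esym/lebesgue_measure_unique => //= _ [[a b]] _ <-.
(* By uniqueness it suffices to compare half-open intervals; reflection moves the closed end from
   right to left and preserves the length. *)
rewrite /pushforward (_ : refl @^-1` _ = `[c - b, c - a[%classic).
  rewrite !lebesgue_measure_itv/= !lte_fin ltrD2l ltrN2.
  by case: ifP => // _; rewrite -!EFinB; congr EFin; ring.
apply/seteqP; split => y; rewrite /refl /= !in_itv/= => /andP[];
  by move=> *; apply/andP; split; lra.
Qed.

Lemma integrable_reflection (f : R -> \bar R) : leb.-integrable setT f ->
  leb.-integrable setT (fun y => f (c - y)%R).
Proof.
move=> /integrableP[mf foo]; apply/integrableP; split.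
  exact: (measurableT_comp mf measurable_refl).
rewrite -(@ge0_integral_pushforward _ _ _ _ _ _ measurable_refl leb setT
  (fun y => `|f y|)%E)//; last exact: measurableT_comp.
rewrite (eq_measure_integral leb)// => A mA _.
exact: lebesgue_measure_reflection.
Qed.

Lemma integral_reflection (f : R -> \bar R) : leb.-integrable setT f ->
  (\int[leb]_y f (c - y)%R = \int[leb]_y f y)%E.
Proof.
move=> intf.
rewrite -(@integral_pushforward _ _ _ _ _ _ measurable_refl leb setT f)//.
- by apply: eq_measure_integral => A mA _; exact: lebesgue_measure_reflection.
- exact: measurable_int intf.
- exact: integrable_reflection.
Qed.

End reflection.

(** If the integral vanished, the function would be zero almost everywhere, although it is positive
    on the interval from [a] to [a + 1], of measure 1. *)
Lemma integral_gt0 {R : realType} (f : R -> R) (a : R) :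
  (@lebesgue_measure R).-integrable setT (EFin \o f) ->
  (forall x, x != a -> 0 < f x) ->
  (0 < \int[@lebesgue_measure R]_x (f x)%:E)%E.
Proof.
move=> intf f_gt0; have mf := measurable_int _ intf.
(* The value [f a] may be negative; [g] repairs this on the null set {a} only. *)
pose g (x : measurableTypeR R) := maxe (f x)%:E 0%E.
have ae_fg : ae_eq (@lebesgue_measure R) setT (EFin \o f) g.
  exists [set a]; split => //; first exact: lebesgue_measure_set1.
  move=> x; apply: contra_notP => /eqP xa /= _.
  by rewrite /g max_l// lee_fin ltW// f_gt0.
have mg : measurable_fun setT g by exact: measurable_maxe.
have -> : (\int[@lebesgue_measure R]_x (f x)%:E =
    \int[@lebesgue_measure R]_x g x)%E.
  exact: ae_eq_integral.
rewrite lt0e integral_ge0 ?andbT; last first.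
  by move=> x _; rewrite /g le_max lexx orbT.
apply/eqP => ig0.
have : (\int[@lebesgue_measure R]_x `|g x| = 0)%E.
  rewrite -[RHS]ig0; apply: eq_integral => x _.
  by rewrite gee0_abs// /g le_max lexx orbT.
move/(ae_eq_integral_abs _ measurableT mg) => -[N [mN N0 subN]].
have : (lebesgue_measure `]a, (a + 1)%R[ <= lebesgue_measure N)%E.
  apply: le_measure; rewrite ?inE// => x /=; rewrite in_itv/= => /andP[ax _].
  apply: subN => /= /(_ I) gx0.
  have : (0 < g x)%E by rewrite /g lt_max lte_fin f_gt0// gt_eqF.
  by rewrite gx0 ltxx.
rewrite [X in (_ <= X)%E]N0 lebesgue_measure_itv/= lte_fin ltrDl ltr01.
by rewrite -EFinB lee_fin addrAC subrr add0r ler10.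
Qed.

(** * The sign of the expected update, by symmetrization about [v] *)

Section update_sign.
Context {R : realType}.
Variables (mu rho beta : R).
Hypothesis rho_gt0 : 0 < rho.
Local Notation leb := (@lebesgue_measure R).
Local Notation N := (gaussian_density mu rho).
Local Notation F := (mu + beta / (2 * rho)).
Local Notation k v := (fun y => N y * sigmoid beta (y - v) * (y - v)).

(** With u = v - mu and z = y - v, the squares in the two exponents are (u - z)^2 and (u + z)^2,
    which differ by 4 u z. *)
Lemma gaussian_density_reflection v y :
  N (2 * v - y) = N y * expR (2 * rho * (y - v) * (v - mu)).
Proof.
rewrite /gaussian_density -[RHS]mulrA -expRD; congr (_ * expR _).
by field.
Qed.

(* The reflection about v multiplies the density by exp(2 rho z (v - mu)) and the
   sigmoid by exp(- beta z), where z = y - v; the product of the two factors is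
   exp(2 rho z (v - F)). *)
Lemma update_symmetrization v y :
  k v y + k v (2 * v - y) =
  N y * sigmoid beta (y - v) *
  ((y - v) * (1 - expR (2 * rho * (y - v) * (v - F)))).
Proof.
have -> : 2 * v - y - v = - (y - v) by ring.
rewrite gaussian_density_reflection sigmoidN.
have -> : 2 * rho * (y - v) * (v - F) =
    2 * rho * (y - v) * (v - mu) + - (beta * (y - v)).
  by field; rewrite gt_eqF.
by rewrite expRD; ring.
Qed.

(** For negative [a], the exponent has the sign opposite to [z], so both factors have the sign of
    [z]. *)
Lemma mul_1BexpR_gt0 (a z : R) : a < 0 -> z != 0 ->
  0 < z * (1 - expR (2 * rho * z * a)).
Proof.
move=> a0 z0; have r2 : 0 < 2 * rho by rewrite mulr_gt0.
case: (ltgtP z 0) z0 => // z_sgn _.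
- rewrite nmulr_rgt0// subr_lt0 expR_gt1.
  by rewrite -(mulrA (2 * rho)) pmulr_rgt0// nmulr_rgt0.
- rewrite pmulr_rgt0// subr_gt0 expR_lt1.
  by rewrite -(mulrA (2 * rho)) pmulr_rlt0// pmulr_rlt0.
Qed.

Variable v : R.
Hypothesis intk : leb.-integrable setT (EFin \o k v).

Let D y := k v y + k v (2 * v - y).

Let intD : leb.-integrable setT (EFin \o D).
Proof.
rewrite (_ : _ \o _ = ((EFin \o k v) \+ (fun y => (k v (2 * v - y))%:E))%E)//.
apply: integrableD => //.
exact: (integrable_reflection (2 * v) intk).
Qed.

(** The reflected term has the same integral as the original, so integrating [D] yields exactly the
    factor 2 in the definition of J. *)
Let integral_symm :
  (\int[leb]_y (D y)%:E = 2%:E * \int[leb]_y (k v y)%:E)%E.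
Proof.
under eq_integral do rewrite EFinD.
rewrite integralD//=; last exact: (integrable_reflection (2 * v) intk).
rewrite (integral_reflection (2 * v) intk).
by rewrite mule_natl mule2n.
Qed.

Lemma update_integral_sign :
  [/\ F < v -> (2%:E * \int[leb]_y (k v y)%:E < 0)%E,
      v = F -> (2%:E * \int[leb]_y (k v y)%:E = 0)%E
    & v < F -> (0 < 2%:E * \int[leb]_y (k v y)%:E)%E].
Proof.
have p_gt0 y : 0 < N y * sigmoid beta (y - v).
  by rewrite mulr_gt0 ?gaussian_density_gt0 ?sigmoid_gt0.
rewrite -integral_symm; split=> vF.
- have -> : (\int[leb]_y (D y)%:E = - \int[leb]_y (- D y)%:E)%E.
    by rewrite -[LHS]oppeK -integralN//; exact: integrable_add_def intD.
  rewrite oppe_lt0; apply: (@integral_gt0 _ _ v) => [|y yv].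
    exact: (integrableN intD).
  rewrite /D update_symmetrization -mulrN mulr_gt0// -mulNr.
  (* With z = y - v and a = v - F > 0, the identity z a = (-z)(-a) rewrites the integrand so that
     [mul_1BexpR_gt0] applies to -a and -z. *)
  rewrite -[2 * rho * (y - v) * _]mulrNN -[- (2 * rho * _)]mulrN.
  by rewrite mul_1BexpR_gt0 ?oppr_lt0 ?subr_gt0// oppr_eq0 subr_eq0.
- rewrite (_ : (fun y => _) = cst 0%E) ?integral0//.
  apply/funext => y; rewrite /D update_symmetrization vF subrr mulr0 expR0.
  by rewrite subrr !mulr0.
- apply: (@integral_gt0 _ _ v) => // y yv.
  rewrite /D update_symmetrization mulr_gt0//.
  by rewrite mul_1BexpR_gt0 ?subr_lt0 ?subr_eq0.
Qed.

End update_sign.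

Lemma integrable_distribution d d' (T : measurableType d)
    (U : measurableType d') (R : realType) (P : probability T R)
    (X : {mfun T >-> U}) (f : U -> \bar R) :
  (distribution P X).-integrable setT f -> P.-integrable setT (f \o X).
Proof.
move=> /integrableP[mf foo]; apply/integrableP; split.
  exact: measurableT_comp.
by move: foo; rewrite ge0_integral_distribution//; exact: measurableT_comp.
Qed.

(* The library's Lebesgue measure lives on [measurableTypeR R], whose sigma-algebra
   is that of [R] under a different measure display. *)
Lemma measurable_Borel_RV d (T : measurableType d) (R : realType)
  (X : {mfun T >-> R}) : measurable_fun setT (X : T -> measurableTypeR R).
Proof. by move=> _ A mA; exact: (measurable_funPT X measurableT A mA). Qed.

Definition Borel_RV d (T : measurableType d) (R : realType)
    (X : {mfun T >-> R}) : {mfun T >-> measurableTypeR R} :=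
  MeasurableFun.Pack (MeasurableFun.Class (isMeasurableFun.Build
    d _ T (measurableTypeR R) X (measurable_Borel_RV X))).

Lemma integral_RV_density d (T : measurableType d) (R : realType)
    (P : probability T R) (X : {RV P >-> R}) (p f : R -> R) :
  (forall x, 0 <= p x) -> (@lebesgue_measure R).-integrable setT (EFin \o p) ->
  has_density X p ->
  (distribution P (Borel_RV X)).-integrable setT (EFin \o f) ->
  (@lebesgue_measure R).-integrable setT (fun y => (p y * f y)%:E) /\
  (\int[distribution P (Borel_RV X)]_y (f y)%:E =
   \int[@lebesgue_measure R]_y (p y * f y)%:E)%E.
Proof.
move=> p0 ip Xp intf.
pose Q : probability (measurableTypeR R) R := distribution P (Borel_RV X).
have pf : (fun y => (p y * f y)%:E) = (fun y => ((f y)%:E * (p y)%:E)%E).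
  by apply/funext => y; rewrite mulrC.
rewrite pf; split.
  have mf := measurable_int _ intf.
  exact: (proj1 (integrable_density (nu := Q) p0 ip Xp mf) intf).
exact: (integral_density (nu := Q) p0 ip Xp intf).
Qed.

Theorem lemma1 (R : realType) (d : measure_display) (T : measurableType d)
    (P : probability T R) (mu rho beta : R)
    (X : {RV P >-> R}) (x : nat -> {RV P >-> R})
    (rho_gt0 : 0 < rho)
    (X_density : has_density X (gaussian_density mu rho))
    (x_iid : iid_samples X x) :
  let J : R -> R := expected_update X beta in
  let F : R := free_energy mu rho beta in
  [/\ (* J is the expected update, alpha being factored out *)
      forall (i : nat) (alpha v : R), 0 < alpha ->
        ('E_P[fun w => (learning_step alpha beta v (x i w) - v)%R]
         = (alpha * J v)%:E)%E,
      (* the expectation and the integral defining J exist and are finite *)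
      forall v : R,
        (J v)%:E =
          (2%:E * 'E_P[fun w => (sigmoid beta (X w - v) * (X w - v))%R])%E
        /\ (J v)%:E =
          (2%:E * \int[lebesgue_measure]_y
             (gaussian_density mu rho y * sigmoid beta (y - v) * (y - v))%:E)%E,
      (* J is twice differentiable *)
      forall v : R, derivable J v 1 /\ derivable (derive1 J) v 1,
      F = mu + beta / (2 * rho)
    & forall v : R, [/\ F < v -> J v < 0, v = F -> J v = 0 & v < F -> 0 < J v]].
Proof.
move=> J F.
pose N := gaussian_density mu rho.
have N0 y : 0 <= N y by rewrite ltW// gaussian_density_gt0.
have iN := integrable_gaussian_density mu rho_gt0.
(* J is studied as an integral of translates of [update] against the law [Q] of [X], whose first
   moment is finite. *)
pose Q : probability (measurableTypeR R) R := distribution P (Borel_RV X).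
have int_id : Q.-integrable setT (EFin : R -> \bar R).
  have mE : measurable_fun setT (EFin : measurableTypeR R -> \bar R).
    exact/measurable_EFinP.
  apply: (proj2 (integrable_density (nu := Q) N0 iN X_density mE)).
  exact: integrable_gaussian_density_id.
have ch := is_derive_continuous (is_derive_update beta).
have ch' := is_derive_continuous (is_derive_update' beta).
have intQ v : Q.-integrable setT (fun y => (update beta (y - v))%:E).
  by apply: integrable_translate => //; exact: linear_growth_update.
have intE v : ('E_P[fun w => (sigmoid beta (X w - v) * (X w - v))%R] =
    \int[Q]_y (update beta (y - v))%:E)%E.
  rewrite unlock (integral_distribution (X := Borel_RV X))//.
    exact: measurable_int (intQ v).
  exact: integrable_distribution (intQ v).
have finE v : (\int[Q]_y (update beta (y - v))%:E)%E \is a fin_num.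
  exact: integrable_fin_num.
have JE v : J v = 2 * \int[Q]_y update beta (y - v).
  by rewrite /J /expected_update intE.
have JEE v : (J v)%:E = (2%:E * \int[Q]_y (update beta (y - v))%:E)%E.
  by rewrite JE EFinM fineK.
have dens v := integral_RV_density N0 iN X_density (intQ v).
have kE v : (fun y => (N y * update beta (y - v))%:E) =
    (fun y => (N y * sigmoid beta (y - v) * (y - v))%:E).
  by apply/funext => y; rewrite mulrA.
have JL v : (J v)%:E = (2%:E * \int[lebesgue_measure]_y
    (gaussian_density mu rho y * sigmoid beta (y - v) * (y - v))%:E)%E.
  by rewrite JEE (dens v).2 kE.
have dJ v : is_derive v (1 : R) J (2 * - \int[Q]_y update' beta (y - v)).
  have -> : J = (fun v => 2 *: (\int[Q]_y update beta (y - v) : R)).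
    by apply/funext => w; rewrite JE.
  apply: is_deriveZ; apply: is_derive_integral_translate => //.
  - exact: is_derive_update.
  - exact: linear_growth_update.
  - exact: linear_growth_update'.
(* J' is again a multiple of an integral of translates, so the same differentiation lemma applies to
   it. *)
have J'E : derive1 J = (fun v => (- 2) *: (\int[Q]_y update' beta (y - v) : R)).
  by apply/funext => v; rewrite derive1E derive_val mulrN -mulNr.
split.
- move=> i alpha v alpha0.
  pose Qi : probability (measurableTypeR R) R :=
    distribution P (Borel_RV (x i)).
  (* Identical distribution gives [x i] and [X] the same law, hence the same integrals of
     [update]. *)
  have QiE A : measurable A -> Qi A = Q A by case: x_iid => _; apply.
  have intQi : Qi.-integrable setT (fun y => (update beta (y - v))%:E).
    have /integrableP[mf foo] := intQ v; apply/integrableP; split => //.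
    by rewrite (eq_measure_integral Q)// => A mA _; exact: QiE.
  have -> : (fun w => learning_step alpha beta v (x i w) - v) =
      (fun w => 2 * alpha * update beta (x i w - v)).
    by apply/funext => w; rewrite /learning_step /update; ring.
  rewrite unlock; under eq_integral do rewrite EFinM.
  rewrite integralZl//; last exact: (integrable_distribution intQi).
  rewrite -(integral_distribution (X := Borel_RV (x i))
    (f := fun y => (update beta (y - v))%:E)).
  + rewrite (eq_measure_integral Q)//; last by move=> A mA _; exact: QiE.
    by rewrite mulrC EFinM -muleA -JEE EFinM.
  + exact: measurable_int intQi.
  + exact: (integrable_distribution intQi).
- by move=> v; rewrite intE.
- move=> v; split; first by case: (dJ v).
  rewrite J'E; apply: derivableZ.
  suff : is_derive v (1 : R) (fun v => \int[Q]_y update' beta (y - v))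
    (- \int[Q]_y update'' beta (y - v)) by case.
  apply: is_derive_integral_translate => //.
  - exact: is_derive_update'.
  - exact: continuous_update''.
  - exact: linear_growth_update'.
  - exact: linear_growth_update''.
- exact: free_energyE.
- move=> v; rewrite /F free_energyE//.
  have intk := (dens v).1; rewrite kE in intk.
  have [] := update_integral_sign rho_gt0 intk.
  rewrite -JL => Jlt0 Jeq0 Jgt0; split.
  + by move/Jlt0; rewrite lte_fin.
  + by move/Jeq0 => -[].
  + by move/Jgt0; rewrite lte_fin.
Qed.
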